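(* For each extremally disconnected Stone space $X$, the poset $\mathcal{IR}(X)$ of interior relations on $X$, ordered by inclusion, is a coframe. Therefore, for each complete boolean algebra $B$, the poset $\mathcal{TNO}(B)$ of tense necessity operators on $B$ is a frame.
   Context: A Stone space is a compact Hausdorff zero-dimensional space; a space is extremally disconnected if the closure of each open set is open. A binary relation $R$ on a Stone space $X$ is continuous if $R[x]=\{y : x\mathrel{R}y\}$ is closed for each $x\in X$ and $R^{-1}[U]=\{x : x \mathrel{R} y \text{ for some } y\in U\}$ is clopen for each clopen $U\subseteq X$. A continuous relation $R$ is an interior relation if, in addition, $R[U]=\{y : x\mathrel{R}y\text{ for some }x\in U\}$ is clopen for each clopen $U\subseteq X$. $\mathcal{IR}(X)$ is the set of interior relations on $X$, ordered by inclusion. A possibility operator on a boolean algebra $B$ is a function $B\to B$ preserving finite joins (including the empty one). Two possibility operators $\Diamond_F,\Diamond_P$ on $B$ are conjugate if for all $a,b\in B$: $\Diamond_F a\wedge b=0\iff\Diamond_P b\wedge a=0$. A possibility operator $\Diamond_F$ is a tense possibility operator if it has a conjugate; in this case $\Box_F=\neg\Diamond_F\neg$ is called a tense necessity operator. $\mathcal{TNO}(B)$ is the set of tense necessity operators on $B$, ordered pointwise: $f\le g$ iff $f(a)\le g(a)$ for all $a\in B$. A frame is a complete lattice $L$ satisfying $a\wedge\bigvee S=\bigvee\{a\wedge b\mid b\in S\}$ for all $a\in L$, $S\subseteq L$; a coframe is a complete lattice satisfying $a\vee\bigwedge S=\bigwedge\{a\vee b\mid b\in S\}$ for all $a\in L$,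 $S\subseteq L$. *)

(* Defs.v *)
From HB Require Import structures.
From mathcomp Require Import all_boot all_order.
From mathcomp Require Import boolp classical_sets topology.

Set Implicit Arguments.
Unset Strict Implicit.
Unset Printing Implicit Defensive.

Set Warnings "-redundant-canonical-projection,-projection-no-head-constant".


Import Order.TTheory.

Local Open Scope classical_set_scope.
Local Open Scope order_scope.

(* In a mere poset, [supremums S] and [infimums S] are the sets, with at most
   one element, of least upper bounds and greatest lower bounds of [S]. *)
Definition complete_lattice d (L : porderType d) : Prop :=
  forall S : set L, supremums S !=set0 /\ infimums S !=set0.

(* m = a /\ \/ S implies m = \/ {a /\ b | b in S} *)
Definition frame d (L : porderType d) : Prop :=
  complete_lattice L /\
  forall (a : L) (S : set L) (s m : L),
    supremums S s -> infimums [set a; s] m ->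
    supremums [set c | exists2 b, S b & infimums [set a; b] c] m.

(* m = a \/ /\ S implies m = /\ {a \/ b | b in S} *)
Definition coframe d (L : porderType d) : Prop :=
  complete_lattice L /\
  forall (a : L) (S : set L) (s m : L),
    infimums S s -> supremums [set a; s] m ->
    infimums [set c | exists2 b, S b & supremums [set a; b] c] m.

(* The library's [zero_dimensional] only asks that points be separated by
   clopen sets, hence the explicit base of clopen sets here. *)
Definition stone_space (X : topologicalType) : Prop :=
  [/\ compact [set: X], hausdorff_space X & basis [set U : set X | clopen U]].

Definition extremally_disconnected (X : topologicalType) : Prop :=
  forall U : set X, open U -> open (closure U).

Definition rel_image (X : Type) (R : set (X * X)) (U : set X) : set X :=
  [set y | exists2 x, U x & R (x, y)].

Definition rel_preimage (X : Type) (R : set (X * X)) (U : set X) : set X :=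
  [set x | exists2 y, U y & R (x, y)].

Definition continuous_relation (X : topologicalType) (R : set (X * X)) : Prop :=
  (forall x, closed [set y | R (x, y)]) /\
  (forall U, clopen U -> clopen (rel_preimage R U)).

Definition interior_relation (X : topologicalType) (R : set (X * X)) : Prop :=
  continuous_relation R /\ (forall U, clopen U -> clopen (rel_image R U)).

(* [set (X * X)] is ordered by inclusion in the library. *)
Definition IR (X : topologicalType) : Type :=
  set_type [set R : set (X * X) | interior_relation R].

HB.instance Definition _ (X : topologicalType) := SubChoice.on (IR X).
HB.instance Definition _ (X : topologicalType) :=
  [SubChoice_isSubPOrder of IR X by <: with set_display].

Lemma IR_leE (X : topologicalType) (R S : IR X) :
  (R <= S) <-> (val R `<=` val S).
Proof. by rewrite -Order.le_val; split=> /subsetPset. Qed.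

Definition possibility_operator d (B : ctbDistrLatticeType d) (f : B -> B) :
    Prop :=
  f \bot = \bot /\ {morph f : a b / a `|` b}.

Definition conjugate d (B : ctbDistrLatticeType d) (f g : B -> B) : Prop :=
  forall a b : B, (f a `&` b = \bot) <-> (g b `&` a = \bot).

Definition tense_possibility_operator d (B : ctbDistrLatticeType d)
    (f : B -> B) : Prop :=
  possibility_operator f /\
  exists2 g : B -> B, possibility_operator g & conjugate f g.

Definition tense_necessity_operator d (B : ctbDistrLatticeType d)
    (h : B -> B) : Prop :=
  exists2 f : B -> B, tense_possibility_operator f &
    h = (fun a => ~` (f (~` a))).

(* [B -> B] is ordered pointwise in the library. *)
Definition TNO d (B : ctbDistrLatticeType d) : Type :=
  set_type [set h : B -> B | tense_necessity_operator h].

HB.instance Definition _ d (B : ctbDistrLatticeType d) := SubChoice.on (TNO B).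
HB.instance Definition _ d (B : ctbDistrLatticeType d) :=
  [SubChoice_isSubPOrder of TNO B by <: with FunOrder.fun_display].

Lemma TNO_leE d (B : ctbDistrLatticeType d) (f g : TNO B) :
  (f <= g) <-> (forall a : B, val f a <= val g a).
Proof. by rewrite -Order.le_val; split=> [/lefP|h]; last exact/lefP. Qed.

(* Main.v *)
(* On a complete boolean algebra the tense necessity operators are the maps with
   a left adjoint, that is, the maps preserving arbitrary meets. They are closed
   under pointwise meets and under the Heyting implication
   [y |-> \meet_(v >= y) (h v -> k v)], hence form a frame. For the coframe of
   interior relations on [X], Stone duality sends [R] to the operator
   [U |-> {x | R[x] is included in U}] on the algebra of clopen sets, which is
   complete because [X] is extremally disconnected; this is an order-reversing
   bijection onto the tense necessity operators, whose inverse relates [x] to [y]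
   when [y] lies in every clopen [U] such that [x] lies in [h U]. *)

Require Import Defs.
From HB Require Import structures.
From mathcomp Require Import all_boot all_order.
From mathcomp Require Import boolp classical_sets topology.

Set Implicit Arguments.
Unset Strict Implicit.
Unset Printing Implicit Defensive.

Import Order.Theory.

Local Open Scope classical_set_scope.
Local Open Scope order_scope.

(** * Completeness and frame criteria in a bare poset *)

Lemma complete_lattice_infimums d (L : porderType d) :
  (forall S : set L, infimums S !=set0) -> complete_lattice L.
Proof.
(* The supremum of [S] is the infimum of its upper bounds. *)
move=> infL S; split=> //; have [s [lbs glbs]] := infL (ubound S).
by exists s; split=> [x Sx|y uby]; [apply: glbs => y; apply | exact: lbs].
Qed.

Lemma infimums2P d (L : porderType d) (a b c : L) :
  infimums [set a; b] c -> forall x, (x <= c) = (x <= a) && (x <= b).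
Proof.
move=> [lbc glbc] x; apply/idP/andP => [xc|[xa xb]].
  by split; apply: (le_trans xc); apply: lbc; [left | right].
by apply: glbc => y [] ->.
Qed.

(** Meeting with [a] has a right adjoint, so it preserves suprema. The implication is phrased
    through the common lower bounds [y] of [x] and [a], so that no binary meet has to be named. *)
Lemma heyting_frame d (L : porderType d) : complete_lattice L ->
  (forall a b : L, exists i, forall x,
    x <= i <-> (forall y, y <= x -> y <= a -> y <= b)) ->
  frame L.
Proof.
move=> cL impL; split=> // a S s m [ubs lubs] /infimums2P mP.
have /andP[ma ms] : (m <= a) && (m <= s) by rewrite -mP.
split=> [c [b Sb /infimums2P cP]|u ubu].
  have /andP[ca cb] : (c <= a) && (c <= b) by rewrite -cP.
  by rewrite mP ca (le_trans cb) ?ubs.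
have [i iP] := impL a u.
suff si : s <= i by exact: (proj1 (iP s) si).
apply: lubs => b Sb; apply/iP => y yb ya.
have [_ [c cP]] := cL [set a; b].
by apply: (@le_trans _ _ c); [rewrite (infimums2P cP) ya | apply: ubu; exists b].
Qed.

(** * Transfer along order-reversing bijections *)

Section AntiIsomorphism.
Context d d' (L : porderType d) (M : porderType d') (phi : L -> M).
Hypothesis phi_anti : forall x y, (phi x <= phi y) = (y <= x).
Hypothesis phi_surj : forall z, exists x, phi x = z.

Lemma anti_infimums (S : set L) s :
  infimums S s <-> supremums (phi @` S) (phi s).
Proof.
split=> -[bs gs]; split.
- by move=> _ [x Sx <-]; rewrite phi_anti; exact: bs.
- move=> z; have [y <-] := phi_surj z => uby.
  rewrite phi_anti; apply: gs => x Sx.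
  by rewrite -phi_anti; apply: uby; exists x.
- by move=> x Sx; rewrite -phi_anti; apply: bs; exists x.
- move=> y lby; rewrite -phi_anti; apply: gs => _ [x Sx <-].
  by rewrite phi_anti; exact: lby.
Qed.

Lemma anti_supremums (S : set L) s :
  supremums S s <-> infimums (phi @` S) (phi s).
Proof.
split=> -[bs gs]; split.
- by move=> _ [x Sx <-]; rewrite phi_anti; exact: bs.
- move=> z; have [y <-] := phi_surj z => lby.
  rewrite phi_anti; apply: gs => x Sx.
  by rewrite -phi_anti; apply: lby; exists x.
- by move=> x Sx; rewrite -phi_anti; apply: bs; exists x.
- move=> y uby; rewrite -phi_anti; apply: gs => _ [x Sx <-].
  by rewrite phi_anti; exact: uby.
Qed.

Lemma anti_frame_coframe : frame M -> coframe L.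
Proof.
move=> [cM frM]; split.
  move=> S; have [[z] + [t]] := cM (phi @` S).
  have [x <-] := phi_surj z; have [y <-] := phi_surj t.
  by move=> /anti_infimums xS /anti_supremums yS; split; [exists y | exists x].
move=> a S s m /anti_infimums sP /anti_supremums.
rewrite image_setU !image_set1 => mP.
apply/anti_infimums; have := frM _ _ _ _ sP mP; congr supremums.
have joinE b c :
    supremums [set a; b] c <-> infimums [set phi a; phi b] (phi c).
  by rewrite anti_supremums image_setU !image_set1.
apply/seteqP; split=> [z [_ [b Sb <-]]|_ [c [b Sb /joinE bc] <-]].
  by have [c <-] := phi_surj z => /joinE bc; exists c => //; exists b.
by exists (phi b) => //; exists b.
Qed.

End AntiIsomorphism.

(** * The frame of tense necessity operators *)

Section TenseNecessity.
Context d (B : ctbDistrLatticeType d).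
Implicit Types (h : B -> B) (x y : B).

(** Disjointness from an element means lying below its complement, so conjugacy of [f] and [g] at
    the complement of [y] is exactly the adjunction. Conversely, left adjoints preserve joins and
    right adjoints preserve meets, which makes [g] and the De Morgan dual of [h] possibility
    operators. *)
Lemma tense_necessityP h : tense_necessity_operator h <->
  exists g : B -> B, forall x y, (g x <= y) = (x <= h y).
Proof.
split=> [[f [_ [g _ fg]] ->]|[g gh]].
  exists g => x y; apply/idP/idP => [gxy|xfy].
    rewrite lexC -disj_leC; apply/eqP/fg/eqP; rewrite disj_leC.
    by rewrite complK.
  rewrite -[y]complK -disj_leC; apply/eqP/fg/eqP; rewrite disj_leC.
  by rewrite lexC.
have h_homo x y : x <= y -> h x <= h y.
  by move=> xy; rewrite -gh (le_trans _ xy) // gh.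
have hgh x : x <= h (g x) by rewrite -gh.
have ghg y : g (h y) <= y by rewrite gh.
have g_homo x y : x <= y -> g x <= g y.
  by move=> xy; rewrite gh (le_trans xy).
have gD x y : g (x `|` y) = g x `|` g y.
  apply/le_anti; rewrite gh !leUx -!gh leUl leUr /=.
  by rewrite !g_homo ?leUl ?leUr.
have hI x y : h (x `&` y) = h x `&` h y.
  apply/le_anti; rewrite -gh !lexI !gh leIl leIr !andbT.
  by rewrite !h_homo ?leIl ?leIr.
exists (fun x => ~` h (~` x)); last by apply/funext => y; rewrite !complK.
split.
  split=> [|x y]; last by rewrite complU hI complI.
  by apply/eqP; rewrite compl0 -lex0 leCx compl0 -gh lex1.
exists g; first by split=> //; apply/eqP; rewrite -lex0 gh le0x.
move=> x y; rewrite meetC.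
split=> /eqP; rewrite !disj_leC => H; apply/eqP; rewrite ?disj_leC.
  by rewrite gh -[h _]complK.
by rewrite complK -gh.
Qed.

Definition to_tno h (th : tense_necessity_operator h) : TNO B :=
  exist _ h (mem_set th).

Hypothesis cB : complete_lattice B.

(** Adjoint functor theorem for posets: the left adjoint sends [x] to the infimum of all [y] with
    [x <= h y]. Preservation of infima is put in terms of lower bounds [z] of the image, so the
    infimum of the image is never named. *)
Lemma meet_preserving_tense h : {homo h : x y / x <= y} ->
  (forall (S : set B) s z, infimums S s -> (forall y, S y -> z <= h y) ->
    z <= h s) ->
  tense_necessity_operator h.
Proof.
move=> hh hinf; apply/tense_necessityP.
pose G x := cid (cB [set y | x <= h y]).2.
exists (fun x => projT1 (G x)) => x y; case: (G x) => g /= gP.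
apply/idP/idP => [gy|xhy]; last by case: gP => + _; apply.
by apply: le_trans (hh _ _ gy); apply: hinf gP _ => z.
Qed.

Lemma tense_meet_preserving h : tense_necessity_operator h ->
  {homo h : x y / x <= y} /\
  (forall (S : set B) s z, infimums S s -> (forall y, S y -> z <= h y) ->
    z <= h s).
Proof.
move=> /tense_necessityP[g gh]; split=> [x y xy|S s z [_ glb] zS].
  by rewrite -gh (le_trans _ xy) // gh.
by rewrite -gh; apply: glb => y Sy; rewrite gh; exact: zS.
Qed.

Lemma tno_complete : complete_lattice (TNO B).
Proof.
apply: complete_lattice_infimums => S.
pose I y := cid (cB [set val k y | k in S]).2.
have IP y x : x <= projT1 (I y) <-> forall k, S k -> x <= val k y.
  case: (I y) => i [lb glb] /=; split=> [xi k Sk|xS].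
    by apply: (le_trans xi); apply: lb; exists k.
  by apply: glb => _ [k Sk <-]; exact: xS.
have Ile y k : S k -> projT1 (I y) <= val k y by move: k; exact/IP.
have tI : tense_necessity_operator (fun y => projT1 (I y)).
  apply: meet_preserving_tense => [x y xy|T t z tT zT].
    apply/IP => k Sk; have [homo_k _] := tense_meet_preserving (set_valP k).
    exact: le_trans (Ile x k Sk) (homo_k _ _ xy).
  apply/IP => k Sk; have [_ inf_k] := tense_meet_preserving (set_valP k).
  by apply: inf_k tT _ => y /zT/IP; apply.
exists (to_tno tI); split=> [k Sk|k lbk]; apply/TNO_leE => y /=.
  exact: Ile.
by apply/IP => l Sl; move: y; apply/TNO_leE; exact: lbk.
Qed.

(** The pointwise implication from [h] to [k] need not be monotone; taking the meet over all [v]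
    above [y] makes it so. *)
Lemma tno_heyting (h k : TNO B) : exists i : TNO B, forall l,
  l <= i <-> (forall m, m <= l -> m <= h -> m <= k).
Proof.
have [hh hinf] := tense_meet_preserving (set_valP h).
have [kh kinf] := tense_meet_preserving (set_valP k).
pose I y := cid (cB [set ~` val h v `|` val k v | v in [set v | y <= v]]).2.
have IP y x : x <= projT1 (I y) <->
    forall v, y <= v -> x `&` val h v <= val k v.
  case: (I y) => i [lb glb] /=; split=> [xi v yv|xS].
    have /(le_trans xi) : i <= ~` val h v `|` val k v by apply: lb; exists v.
    by rewrite -leBLR diffE complK.
  apply: glb => _ [v yv <-]; rewrite -leBLR diffE complK; exact: xS.
have tI : tense_necessity_operator (fun y => projT1 (I y)).
  apply: meet_preserving_tense => [x y xy|S s z sS zS].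
    by apply/IP => v yv; move: (le_trans xy yv); move: v {yv}; exact/IP.
  apply/IP => v sv.
  (* [v] is the infimum of [{y `|` v | y in S}], by distributivity. *)
  have vS : infimums [set y `|` v | y in S] v.
    split=> [_ [y _ <-]|w lbw]; first exact: leUr.
    have : w `\` v <= s.
      by apply: sS.2 => y Sy; rewrite leBLR joinC; apply: lbw; exists y.
    by rewrite leBLR (join_l sv).
  apply: kinf vS _ => _ [y Sy <-].
  (* Monotonicity of [h] replaces [v] by its join with [y], an element above [y] to which the bound
     [zS y] applies. *)
  apply: le_trans (_ : z `&` val h (y `|` v) <= _).
    by rewrite leI2 // hh // leUr.
  by move/IP: (zS y Sy); apply; exact: leUl.
exists (to_tno tI) => l; split=> [li m ml mh|lhk].
  apply/TNO_leE => y.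
  have /TNO_leE/(_ y)/= /IP/(_ y (lexx _)) := le_trans ml li.
  by rewrite meet_l //; move: y; exact/TNO_leE.
have [lh linf] := tense_meet_preserving (set_valP l).
apply/TNO_leE => y; apply/IP => v yv.
(* The operator to test against is the pointwise meet of [l] and [h]; its value at [v] yields the
   bound because [l y <= l v]. *)
have tm : tense_necessity_operator (fun y => val l y `&` val h y).
  apply: meet_preserving_tense => [a b ab|S s z sS zS].
    by rewrite leI2 ?lh ?hh.
  rewrite lexI (linf _ _ _ sS) ?(hinf _ _ _ sS) // => w /zS.
    by rewrite lexI => /andP[].
  by rewrite lexI => /andP[].
pose m : TNO B := to_tno tm.
have ml : m <= l by apply/TNO_leE => w; exact: leIl.
have mh : m <= h by apply/TNO_leE => w; exact: leIr.
have /TNO_leE/(_ v) := lhk m ml mh.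
by apply: le_trans; rewrite leI2 // lh.
Qed.

Lemma tno_frame : frame (TNO B).
Proof. exact: heyting_frame tno_complete tno_heyting. Qed.

End TenseNecessity.

(** * The Boolean algebra of clopen sets *)

Definition clopens (X : topologicalType) : Type :=
  set_type [set U : set X | clopen U].

HB.instance Definition _ (X : topologicalType) := SubChoice.on (clopens X).
HB.instance Definition _ (X : topologicalType) :=
  [SubChoice_isSubPOrder of clopens X by <: with set_display].

Section ClopenAlgebra.
Context (X : topologicalType).
Implicit Types U V W : clopens X.

Definition to_clopens (A : set X) (cA : clopen A) : clopens X :=
  exist _ A (mem_set cA).

Definition clopens_meet U V := to_clopens (clopenI (set_valP U) (set_valP V)).
Definition clopens_join U V := to_clopens (clopenU (set_valP U) (set_valP V)).
Definition clopens_compl U :=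
  to_clopens (@clopenC X _ set0 (set_valP U)).

Let meetC : commutative clopens_meet.
Proof. by move=> U V; apply/val_inj; exact: setIC. Qed.
Let joinC : commutative clopens_join.
Proof. by move=> U V; apply/val_inj; exact: setUC. Qed.
Let meetA : associative clopens_meet.
Proof. by move=> U V W; apply/val_inj; exact: setIA. Qed.
Let joinA : associative clopens_join.
Proof. by move=> U V W; apply/val_inj; exact: setUA. Qed.
Let joinKI V U : clopens_meet U (clopens_join U V) = U.
Proof. by apply/val_inj; exact: joinKI. Qed.
Let meetKU V U : clopens_join U (clopens_meet U V) = U.
Proof. by apply/val_inj; exact: meetKU. Qed.
Let leEmeet U V : (U <= V) = (clopens_meet U V == U).
Proof. by rewrite -Order.le_val leEmeet -val_eqE. Qed.
Let meetUl : left_distributive clopens_meet clopens_join.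
Proof. by move=> U V W; apply/val_inj; exact: setIUl. Qed.

HB.instance Definition _ := Order.POrder_Meet_isDistrLattice.Build
  set_display (clopens X) meetC joinC meetA joinA joinKI meetKU leEmeet meetUl.

Let le0U U : to_clopens clopen0 <= U.
Proof. by rewrite -Order.le_val; exact: le0x. Qed.
Let leU1 U : U <= to_clopens clopenT.
Proof. by rewrite -Order.le_val; exact: lex1. Qed.

HB.instance Definition _ := Order.hasBottom.Build set_display (clopens X) le0U.
HB.instance Definition _ := Order.hasTop.Build set_display (clopens X) leU1.

Let joinUC U : U `|` clopens_compl U = \top.
Proof. by apply/val_inj; exact: setUv. Qed.
Let meetUC U : U `&` clopens_compl U = \bot.
Proof. by apply/val_inj; exact: setICr. Qed.

HB.instance Definition _ := Order.TBDistrLattice_hasComplement.Build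
  set_display (clopens X) joinUC meetUC.

End ClopenAlgebra.

Lemma clopens_leE (X : topologicalType) (U V : clopens X) :
  (U <= V) <-> (val U `<=` val V).
Proof. by rewrite -Order.le_val; split=> /subsetPset. Qed.

Lemma val_clopensC (X : topologicalType) (U : clopens X) :
  val (~` U) = (~` val U)%classic.
Proof. by []. Qed.

(** The infimum of [S] is the interior of its intersection, that is, the complement of the closure
    of the union [O] of the complements. Extremal disconnectedness makes that closure clopen. *)
Lemma clopens_complete (X : topologicalType) :
  extremally_disconnected X -> complete_lattice (clopens X).
Proof.
move=> edX; apply: complete_lattice_infimums => S.
pose O := \bigcup_(U in S) ~` val U.
have openO : open O.
  by apply: bigcup_open => U _; apply: closed_openC; case: (set_valP U).
have cO : clopen (~` closure O).
  by apply: (@clopenC _ _ set0); split; [exact: edX | exact: closed_closure].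
exists (to_clopens cO); split=> [U SU|V lbV]; apply/clopens_leE => x /= Vx.
  by apply: contrapT => nUx; apply: Vx; apply: subset_closure; exists U.
have [oV _] := set_valP V.
move=> /(_ _ (open_nbhs_nbhs (conj oV Vx)))[y [[U SU nUy] Vy]].
by apply: nUy; apply: (proj1 (clopens_leE V U)) Vy; exact: lbV.
Qed.

(** * From operators to interior relations *)

Section RelationOfOperator.
Context (X : topologicalType).
Implicit Types (h g : clopens X -> clopens X) (U V : clopens X).

Definition operator_rel h : set (X * X) :=
  [set p | forall U, val (h U) p.1 -> val U p.2].

(** The converse relation comes from the De Morgan dual of the left adjoint; the unit of the
    adjunction gives the inclusion. *)
Lemma operator_rel_conj h g (gh : forall U V, (g U <= V) = (U <= h V)) x y :
  operator_rel h (x, y) -> operator_rel (fun U => ~` g (~` U)) (y, x).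
Proof.
move=> hxy U /= gUy; apply: contrapT => nUx; apply: gUy; apply: hxy => /=.
have /clopens_leE : ~` U <= h (g (~` U)) by rewrite -gh.
exact.
Qed.

Hypothesis cX : compact [set: X].

(* By compactness, if no [y] outside [U] is related to [x], then finitely many,
   hence one, of the [V] with [x] in [h V] already lies inside [U]. *)
Lemma operator_rel_box h : tense_necessity_operator h -> forall x U,
  val (h U) x <-> forall y, operator_rel h (x, y) -> val U y.
Proof.
move=> /tense_necessityP[g gh] x U; split=> [hUx y|xU]; first exact.
have hT : val (h \top) x.
  by have /clopens_leE : \top <= h \top by [rewrite -gh lex1]; exact.
apply: contrapT => nhUx.
(* A cluster point of [F] lies in every closed set [V] minus [U], hence is related to [x] and lies
   outside [U]. *)
pose F := filter_from [set V | val (h V) x] (fun V => val V `\` val U).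
have FF : ProperFilter F.
  apply: filter_from_proper; first apply: filter_from_filter.
  - by exists \top; exact: hT.
  - move=> V W hV hW; exists (V `&` W) => [|y [[Vy Wy] nUy]//].
    have /clopens_leE : h V `&` h W <= h (V `&` W).
      by rewrite -gh lexI !gh leIl leIr.
    by apply; split.
  move=> V hV; apply: contrapT => /nonemptyPn VU.
  apply: nhUx; have /clopens_leE : h V <= h U; last exact.
  rewrite -gh; apply: le_trans (_ : V <= _); first by rewrite gh.
  by apply/clopens_leE; rewrite -setD_eq0.
have clF V : closed (val V `\` val U).
  apply: closedI; first by case: (set_valP V).
  by apply: open_closedC; case: (set_valP U).
have [|y [_ yF]] := cX FF; first exact: filterT.
have VUy V : val (h V) x -> (val V `\` val U) y.
  move=> hV; apply: (clF V) => A Ay; apply: yF Ay.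
  by exists V.
suff /xU Uy : operator_rel h (x, y).
  by have [_] := VUy _ hT; apply.
by move=> V /VUy[].
Qed.

Lemma operator_rel_preimage h (A : set X) : tense_necessity_operator h ->
  clopen A -> clopen (rel_preimage (operator_rel h) A).
Proof.
move=> th cA.
suff -> : rel_preimage (operator_rel h) A = val (~` h (~` to_clopens cA)).
  exact: set_valP.
apply/seteqP; split=> x /=.
  by move=> [y Ay xy] /(operator_rel_box th)/(_ y xy).
move=> nhx; apply: contrapT => nAx; apply: nhx.
apply/(operator_rel_box th) => y xy; rewrite val_clopensC => Ay.
by apply: nAx; exists y.
Qed.

Lemma operator_rel_interior h : tense_necessity_operator h ->
  interior_relation (operator_rel h).
Proof.
move=> th; split; [split=> [x|A]|move=> A cA].
- rewrite (_ : mkset _ = \bigcap_(U in [set U | val (h U) x]) val U).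
    by apply: closed_bigI => U _; case: (set_valP U).
  by apply/seteqP; split=> y xy U; [exact: xy | exact: xy].
- exact: operator_rel_preimage.
have /tense_necessityP[g gh] := th.
(* [k] is the necessity operator of the converse relation, so images under the relation become
   preimages under that of [k]. *)
pose k U := ~` g (~` U).
have kh U V : (~` h (~` U) <= V) = (U <= k V) by rewrite leCx -gh lexC.
have tk : tense_necessity_operator k.
  by apply/tense_necessityP; exists (fun U => ~` h (~` U)).
suff -> : rel_image (operator_rel h) A = rel_preimage (operator_rel k) A.
  exact: operator_rel_preimage.
apply/seteqP; split=> y [x Ax xy]; exists x => //.
  exact: operator_rel_conj gh _ _ xy.
(* Passing to the converse twice gives back [h], by double complementation. *)
have := operator_rel_conj kh xy; congr (operator_rel _ (x, y)).
by apply/funext => U; rewrite !complK.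
Qed.

End RelationOfOperator.

(** * From interior relations to operators, and the duality *)

Section OperatorOfRelation.
Context (X : topologicalType).
Implicit Types (R S : IR X) (U V : clopens X).

Lemma rel_preimage_clopen R U : clopen (rel_preimage (val R) (val U)).
Proof. by have [[_ +] _] := set_valP R; apply; exact: set_valP. Qed.

Lemma rel_image_clopen R U : clopen (rel_image (val R) (val U)).
Proof. by have [_ +] := set_valP R; apply; exact: set_valP. Qed.

Definition rel_box R U : clopens X :=
  ~` to_clopens (rel_preimage_clopen R (~` U)).

Lemma rel_boxP R U x :
  val (rel_box R U) x <-> forall y, val R (x, y) -> val U y.
Proof.
rewrite val_clopensC; split=> [nx y xy|xU [y nUy /xU]//].
by apply: contrapT => nUy; apply: nx; exists y.
Qed.

(** The left adjoint is the direct image, which stays within the clopen sets by the condition that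
    sets interior relations apart from continuous ones. *)
Lemma rel_box_tense R : tense_necessity_operator (rel_box R).
Proof.
apply/tense_necessityP; exists (fun U => to_clopens (rel_image_clopen R U)).
move=> U V; apply/idP/idP => /clopens_leE UV; apply/clopens_leE.
  by move=> x Ux; apply/rel_boxP => y xy; apply: UV; exists x.
by move=> y [x /UV/rel_boxP]; apply.
Qed.

Definition IR_operator R : TNO (clopens X) := to_tno (rel_box_tense R).

Lemma operator_rel_rel_box R : stone_space X ->
  operator_rel (rel_box R) = val R.
Proof.
move=> [_ _ [_ clopenX]]; apply/seteqP; split=> -[x y]; last first.
  by move=> xy U /rel_boxP; apply.
move=> /= xy; have [[/(_ x) clR _] _] := set_valP R.
apply: contrapT => nxy.
(* The clopen base separates [y] from the closed set of successors of [x]; the complement of [V] is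
   then a clopen set violating [xy]. *)
have /clopenX[V [cV Vy] VR] : nbhs y (~` [set z | val R (x, z)]).
  by apply: open_nbhs_nbhs; split=> //; exact: closed_openC.
have : val (~` to_clopens cV) y; last by rewrite val_clopensC; exact.
apply: xy; apply/rel_boxP => z xz; rewrite val_clopensC => Vz.
exact: VR Vz xz.
Qed.

Lemma IR_operator_anti : stone_space X ->
  forall R S, (IR_operator R <= IR_operator S) = (S <= R).
Proof.
move=> sX R S; apply/idP/idP => [/TNO_leE RS|/IR_leE SR].
  (* Both relations are recovered from their operators, and [operator_rel] reverses the order. *)
  apply/IR_leE; rewrite -!operator_rel_rel_box // => -[x y] xy U.
  by move=> /(proj1 (clopens_leE _ _) (RS U)); exact: xy.
apply/TNO_leE => U; apply/clopens_leE => x /rel_boxP xU.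
by apply/rel_boxP => y /SR; exact: xU.
Qed.

Definition to_IR (A : set (X * X)) (iA : interior_relation A) : IR X :=
  exist _ A (mem_set iA).

Lemma IR_operator_surj : stone_space X ->
  forall h : TNO (clopens X), exists R, IR_operator R = h.
Proof.
move=> [cX _ _] h; have th := set_valP h.
exists (to_IR (operator_rel_interior cX th)).
apply/val_inj/funext => U; apply/val_inj/seteqP; split=> x; first by move=> /rel_boxP/(operator_rel_box cX th).
by move=> /(operator_rel_box cX th) xU; apply/rel_boxP.
Qed.

End OperatorOfRelation.

Theorem proposition4p8 :
  (forall X : topologicalType,
     stone_space X -> extremally_disconnected X -> coframe (IR X)) /\
  (forall (d : Order.disp_t) (B : ctbDistrLatticeType d),
     complete_lattice B -> frame (TNO B)).
Proof.
split=> [X sX edX|d B]; last exact: tno_frame.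
apply: (anti_frame_coframe (IR_operator_anti sX) (IR_operator_surj sX)).
exact/tno_frame/clopens_complete.
Qed.
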